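(* Let $n\ge1$ and $m^{(n)}=(m_1,\dots,m_n)\in\mathbb{R}^n$. If all the matrices $D_j$, $j=1,\dots,n$ (defined in the context), are positive definite, then $m^{(n)}$ is realizable on $\mathbb{N}_0$, and in fact I-realizable.
   Context: $\mathbb{N}_0=\{0,1,2,\dots\}$; $m_0=1$ by convention. $m^{(n)}$ is realizable on $\mathbb{N}_0$ if there is a probability measure $\mu$ on $\mathbb{N}_0$ with $\int x^k\,d\mu(x)=m_k$ for $k=1,\dots,n$. For $P(x)=\sum_{k=0}^n p_kx^k$, $L_P(m)=\sum_{k=0}^n p_km_k$. For $k\ge0$, $\mathcal{P}_k$ is the set of monic polynomials of degree $k$ with $k$ distinct roots in $\mathbb{N}_0$ which are nonnegative on $\mathbb{N}_0$ ($\mathcal{P}_0=\{1\}$). A realizable $m^{(n)}$ is I-realizable if $L_P(m)>0$ for all $P\in\mathcal{P}_n\cup\mathcal{P}_{n-1}$. For $k\ge0$ define the $(k+1)\times(k+1)$ matrices $A(k)=(m_{i+j})_{i,j=0}^k$, $B(k)=(m_{i+j+1})_{i,j=0}^k$, and $H(k)=(H(k)_{il})_{i,l=0}^k$ with $$H(k)_{il}=0\ \text{ if } i>l,\qquad H(k)_{il}=(-1)^{l-i}\binom{l}{i}\ \text{ if } i\le l.$$ Then $$D_{2k}=\tfrac12\bigl(H(k)^TA(k)+A(k)H(k)\bigr),\qquad D_{2k+1}=\tfrac12\bigl(H(k)^TB(k)+B(k)H(k)\bigr).$$ *)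

(* Defs.v *)
From mathcomp Require Import all_boot all_order all_algebra.
From mathcomp Require Import all_classical all_reals all_analysis.
From mathcomp Require Import sesquilinear.

Set Implicit Arguments.
Unset Strict Implicit.
Unset Printing Implicit Defensive.

Import Order.TTheory GRing.Theory Num.Theory.

Local Open Scope ring_scope.

Section TruncatedMoments.
Variable R : realType.

(* A vector m of R^n lists m_1, ..., m_n (m_(k+1) is at position k of the
   tuple); the convention m_0 = 1 is the added head.  Indices k > n give the
   junk value 0 and are never reached below. *)
Definition mom n (m : n.-tuple R) (k : nat) : R := (1 :: m)`_k.

(* nat carries its discrete sigma-algebra.  The integrands are nonnegative, so
   equality with a real number includes integrability. *)
Definition realizable n (m : n.-tuple R) : Prop :=
  exists mu : probability nat R,
    forall k : nat, (1 <= k <= n)%N ->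
      (\int[mu]_x (((x%:R : R) ^+ k)%:E) = (mom m k)%:E)%E.

(* L_P(m), meaningful for size P <= n.+1, i.e. deg P <= n. *)
Definition Lfun n (m : n.-tuple R) (P : {poly R}) : R :=
  \sum_(k < size P) P`_k * mom m k.

Definition Pset (k : nat) (P : {poly R}) : Prop :=
  [/\ P \is monic,
      size P = k.+1,
      exists s : seq nat,
        [/\ uniq s, size s = k & all (fun a => root P a%:R) s]
    & forall x : nat, 0 <= P.[x%:R]].

(* n.-1 is n - 1 only for n >= 1, the only case in which it is used. *)
Definition I_realizable n (m : n.-tuple R) : Prop :=
  realizable m /\
  (forall P : {poly R}, Pset n P \/ Pset n.-1 P -> 0 < Lfun m P).

Definition Amx n (m : n.-tuple R) (k : nat) : 'M[R]_k.+1 :=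
  \matrix_(i, j) mom m (i + j)%N.

Definition Bmx n (m : n.-tuple R) (k : nat) : 'M[R]_k.+1 :=
  \matrix_(i, j) mom m (i + j).+1.

Definition Hmx (k : nat) : 'M[R]_k.+1 :=
  \matrix_(i, l) if (i <= l)%N then (-1) ^+ (l - i)%N * ('C(l, i))%:R else 0.

Definition Dmx n (m : n.-tuple R) (j : nat) : 'M[R]_((j./2).+1) :=
  let k := j./2 in
  let M := if odd j then Bmx m k else Amx m k in
  2^-1 *: ((Hmx k)^T *m M + M *m Hmx k).

Definition posdefmx d (M : 'M[R]_d) : Prop :=
  M \is symmetricmx /\
  (forall v : 'cV[R]_d, v != 0 -> 0 < (v^T *m M *m v) 0 0).

End TruncatedMoments.

(* Main.v *)
From HB Require Import structures.
Require Import Defs.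
From mathcomp Require Import all_boot all_order all_algebra.
From mathcomp Require Import all_classical all_reals all_analysis.
From mathcomp Require Import sesquilinear ring lra zify.

(* With [p x = sum_l v_l x^l] one has [v^T D_j v = L(x^(j mod 2) p(x) p(x-1))],
   and every polynomial of P_j has the form [x^(j mod 2) p(x) p(x-1)], whence
   the positivity of L on P_n and P_(n-1).  A representing measure is found as
   in the dual simplex method.  Put an arbitrary value on the moment of order
   n+1 and minimize L over P_(n+1); a minimizer exists because D_(n-1) is
   positive definite, which makes L(x^(..) p(x) p(x-1)) coercive in p monic.
   The interpolatory quadrature at the n+1 roots of the minimizer has
   nonnegative weights: deleting a root either leaves a polynomial of P_n, or
   the root can be exchanged for another natural number within P_(n+1), and
   minimality gives the sign of the weight. *)

Set Implicit Arguments.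
Unset Strict Implicit.
Unset Printing Implicit Defensive.

Import Order.TTheory GRing.Theory Num.Theory.

(** * Node sets: pairing into neighbours and exchange of one node *)

(* Equivalently, [prod_(a in s) (x - a)] is nonnegative on the naturals. *)
Definition even_above (s : seq nat) : Prop :=
  uniq s /\ forall x, x \notin s -> ~~ odd (count (ltn x) s).

Lemma even_above_perm s s' : perm_eq s s' -> even_above s -> even_above s'.
Proof.
move=> ss' [us es]; split; first by rewrite -(perm_uniq ss').
by move=> x; rewrite -(perm_mem ss') -(permP ss'); apply: es.
Qed.

(** The two largest nodes are neighbours: otherwise the predecessor of the largest is not a node and
    has exactly one node above it. Removing such a pair changes no parity below it, so induction
    applies. A last unpaired node must be 0, since otherwise 0 would have one node above it. *)
Lemma even_above_sorted s : even_above s -> sorted gtn s ->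
  exists t : seq nat, size t = (size s)./2 /\
    perm_eq s (nseq (odd (size s)) 0 ++ t ++ map S t).
Proof.
have [k] := ubnP (size s); elim: k s => // k IH [_ _ _|b [_ [ub eb] _|a s]].
- by exists [::].
- exists [::]; split=> //=.
  case: b eb {ub} => // b /(_ 0%N); rewrite inE /=.
  by move/(_ isT).
move=> /= ltk [us es] /andP[ltab pas].
have alls : all (gtn a) s.
  by apply: order_path_min pas => x y z /=; lia.
have count0 x : (a <= x)%N -> count (ltn x) s = 0%N.
  move=> ax; apply/eqP; rewrite -leqn0 leqNgt -has_count -all_predC.
  by apply: sub_all alls => y /=; lia.
have eab : b = a.+1.
  apply/eqP; case: (altP (b =P a.+1)) => // nab; have := es b.-1.
  have nbs : b.-1 \notin s.
    by apply/negP => /(allP alls) /=; lia.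
  rewrite !inE negb_or negb_or nbs /= count0; last by lia.
  have -> : (b.-1 < b)%N by lia.
  have -> : (b.-1 < a)%N = false by lia.
  have -> : (b.-1 == b) = false by lia.
  have -> : (b.-1 == a) = false by lia.
  by move/(_ isT).
have [||t [st pt]] := IH s _ _ (path_sorted pas); first by lia.
  split; first by move: us => /= /and3P[].
  move=> x xs; have [ax|xa] := leqP a x; first by rewrite count0.
  have := es x; rewrite !inE !negb_or xs /= xa (ltn_trans xa ltab).
  by rewrite !addnA oddD /=; apply; lia.
exists (a :: t); split => /=; first by rewrite st.
rewrite eab negbK; apply/permP => q.
by rewrite /= (permP pt) !count_cat /= !count_cat /=; lia.
Qed.

Lemma even_above_pairs s : even_above s ->
  exists t : seq nat, size t = (size s)./2 /\
    perm_eq s (nseq (odd (size s)) 0 ++ t ++ map S t).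
Proof.
move=> es; have pss : perm_eq s (sort geq s) by rewrite perm_sym perm_sort.
have ess := even_above_perm pss es.
have srt : sorted gtn (sort geq s).
  rewrite gtn_sorted_uniq_geq ess.1; apply: sort_sorted => x y.
  exact: leq_total.
have [t [st pt]] := even_above_sorted ess srt.
move: st pt; rewrite size_sort => st pt; exists t; split=> //.
exact: perm_trans pss pt.
Qed.

(** Deleting [b] flips the parity at every point below [b] and makes [b] a new non-node. If the
    count above [b] is odd, the nearest gap [c] above [b] repairs both; if it is even, the nearest
    gap below [b] does. All points strictly between [b] and [c] are nodes, so no parity condition
    arises there. With no gap below an even [b], plain deletion is harmless. *)
Lemma even_above_exchange s b : even_above s -> b \in s ->
  [\/ ~~ odd (count (ltn b) s) /\ even_above (rem b s),
      odd (count (ltn b) s) /\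
        exists2 c, (b < c)%N & even_above (c :: rem b s) |
      ~~ odd (count (ltn b) s) /\
        exists2 c, (c < b)%N & even_above (c :: rem b s)].
Proof.
move=> [us es] bs.
have ur : uniq (rem b s) by exact: rem_uniq.
have memr x : (x \in rem b s) = (x != b) && (x \in s) by rewrite mem_rem_uniq.
have cntr x : count (ltn x) s = ((x < b) + count (ltn x) (rem b s))%N.
  by rewrite (permP (perm_to_rem bs)).
have [odb|evb] := boolP (odd (count (ltn b) s)).
  have exc : exists c, (b < c)%N && (c \notin s).
    exists (\max_(a <- s) a).+1; apply/andP; split.
      by rewrite ltnS (leq_bigmax_seq (F := id)).
    apply/negP => ms; suff : (\max_(a <- s) a < \max_(a <- s) a)%N by rewrite ltnn.
    exact: (leq_bigmax_seq (F := id)) ms _.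
  case: (ex_minnP exc) => c /andP[bc cs] cmin.
  constructor 2; split=> //; exists c => //; split.
    by rewrite /= ur memr (negbTE cs) andbF.
  move=> x; rewrite inE memr negb_or negb_and negbK /= => /andP[xc /orP[/eqP->|xs]].
    by move: odb; rewrite cntr ltnn add0n bc /= => ->.
  have := es x xs; rewrite cntr.
  have -> // : (x < c)%N = (x < b)%N.
  case: (ltngtP x b) => xb; first by rewrite (ltn_trans xb bc).
    by have := cmin x; rewrite xb xs /= => /(_ isT); lia.
  by move: xs; rewrite xb bs.
have [exc|nexc] := pselect (exists c, (c < b)%N && (c \notin s)).
  case: (@ex_maxnP _ b exc); first by move=> i /andP[/ltnW].
  move=> c /andP[cb cs] cmax.
  constructor 3; split=> //; exists c => //; split.
    by rewrite /= ur memr (negbTE cs) andbF.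
  move=> x; rewrite inE memr negb_or negb_and negbK /= => /andP[xc /orP[/eqP->|xs]].
    move: evb; rewrite cntr ltnn add0n ltnNge (ltnW cb) //.
  have := es x xs; rewrite cntr.
  have -> // : (x < c)%N = (x < b)%N.
  case: (ltngtP x b) => xb.
  - by have := cmax x; rewrite xb xs /= => /(_ isT); lia.
  - by apply/negbTE; rewrite -leqNgt; lia.
  - by move: xs; rewrite xb bs.
constructor 1; split=> //; split=> // x.
rewrite memr negb_and negbK => /orP[/eqP->|xs].
  by move: evb; rewrite cntr ltnn.
have := es x xs; rewrite cntr.
suff -> : (x < b)%N = false by [].
by apply/negP => xb; apply: nexc; exists x; rewrite xb.
Qed.

Local Open Scope ring_scope.

(** * Positive definite matrices and bounds on linear functionals *)

Section PositiveDefinite.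
Variables (R : realType) (d : nat) (M : 'M[R]_d).
Hypothesis posM : posdefmx M.

Lemma posdefmx_unit : M \in unitmx.
Proof.
rewrite -row_free_unit -kermx_eq0; apply/negP => /negP/matrix0Pn[i [j kij]].
have kM : row i (kermx M) *m M = 0 by rewrite -row_mul mulmx_ker row0.
have rN0 : (row i (kermx M))^T != 0.
  by apply: contraNneq kij => /colP/(_ j); rewrite !mxE => ->.
by have := posM.2 _ rN0; rewrite trmxK kM mul0mx mxE ltxx.
Qed.

Lemma posdefmx_tr : M^T = M.
Proof.
have [+ _] := posM; rewrite is_hermitianmxE expr0 scale1r => /eqP {2}->.
by rewrite map_mx_id.
Qed.

(* Any linear functional [w] is [u^T M] with [u = M^-1 w^T], so this is
   Cauchy-Schwarz for the scalar product defined by [M]. *)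
Lemma posdefmx_functional_bound (w : 'rV[R]_d) : exists2 C : R, 0 <= C &
  forall v : 'cV[R]_d, (w *m v) 0 0 ^+ 2 <= C * (v^T *m M *m v) 0 0.
Proof.
pose b (x y : 'cV[R]_d) := (x^T *m M *m y) 0 0.
have bC x y : b x y = b y x.
  rewrite /b; have -> : x^T *m M *m y = (y^T *m M *m x)^T.
    by rewrite !trmx_mul trmxK posdefmx_tr mulmxA.
  by rewrite mxE.
have b_ge0 x : 0 <= b x x.
  have [->|x0] := eqVneq x 0; first by rewrite /b mulmx0 mxE.
  by apply: ltW; apply: posM.2.
have bD s x y : b (x - s *: y) (x - s *: y) =
    b x x - 2 * s * b x y + s ^+ 2 * b y y.
  have e : b y x = b x y by rewrite bC.
  have tE : (x - s *: y)^T = x^T - s *: y^T by rewrite linearB linearZ.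
  move: e; rewrite /b tE mulmxBr !mulmxBl -!scalemxAr -!scalemxAl.
  move: (x^T *m M *m x) (x^T *m M *m y) (y^T *m M *m x) (y^T *m M *m y) => X1 X2 X3 X4.
  by rewrite !mxE => ->; ring.
pose u := invmx M *m w^T.
have wu v : (w *m v) 0 0 = b u v.
  rewrite /b /u trmx_mul trmxK trmx_inv posdefmx_tr.
  by rewrite -[_ *m _ *m M]mulmxA mulVmx ?posdefmx_unit // mulmx1.
exists (b u u) => // v; rewrite wu -/(b v v).
have [u0|u0] := eqVneq u 0.
  by rewrite u0 /b trmx0 !mul0mx mxE mul0r expr0n.
have uu : 0 < b u u by exact: posM.2.
(* The form is evaluated at the component of [v] orthogonal to [u]. *)
have := b_ge0 (v - (b u v / b u u) *: u).
rewrite bD (bC v u) => h.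
have : 0 <= b u u * (b v v - 2 * (b u v / b u u) * b u v
    + (b u v / b u u) ^+ 2 * b u u) by rewrite mulr_ge0.
suff -> : b u u * (b v v - 2 * (b u v / b u u) * b u v
    + (b u v / b u u) ^+ 2 * b u u) = b u u * b v v - b u v ^+ 2 by rewrite subr_ge0.
by field; rewrite gt_eqF.
Qed.

End PositiveDefinite.

(** * The moment functional and the quadratic forms of the matrices [Dmx] *)

Section MomentFunctional.
Variables (R : realType) (n : nat) (m : n.-tuple R).
Local Notation L := (Defs.Lfun m).

Lemma mom_default k : (n < k)%N -> mom m k = 0.
Proof. by move=> nk; rewrite /mom nth_default //= size_tuple. Qed.

(** Coefficients vanish from the size on and [mom] vanishes beyond [n], so both sums extend to a
    common range. A range independent of [P] makes linearity on all polynomials immediate. *)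
Lemma LfunE P : L P = \sum_(k < n.+1) P`_k * mom m k.
Proof.
pose N := maxn (size P) n.+1.
have widen d : (d <= N)%N -> (forall k, (d <= k)%N -> P`_k * mom m k = 0) ->
    \sum_(k < d) P`_k * mom m k = \sum_(k < N) P`_k * mom m k.
  move=> dN z; rewrite (big_ord_widen N (fun k => P`_k * mom m k) dN) big_mkcond.
  by apply: eq_bigr => k _; case: ltnP => // /z ->.
rewrite /Defs.Lfun !widen ?leq_maxl ?leq_maxr // => k dk.
  by rewrite mom_default // mulr0.
by rewrite nth_default // mul0r.
Qed.

Lemma Lfun_is_linear : linear_for *%R L.
Proof.
move=> a P Q; rewrite !LfunE big_distrr -big_split; apply: eq_bigr => k _ /=.
by rewrite coefD coefZ mulrDl mulrA.
Qed.

HB.instance Definition _ :=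
  GRing.isLinear.Build R {poly R} R *%R (Defs.Lfun m) Lfun_is_linear.

Lemma LfunXn k : L 'X^k = mom m k.
Proof.
have [kn|nk] := leqP k n.
  rewrite LfunE (bigD1 (Ordinal (kn : (k < n.+1)%N))) //= coefXn eqxx mul1r.
  rewrite big1 ?addr0 // => i ik; rewrite coefXn.
  case: eqP => [e|]; last by rewrite mul0r.
  by case/eqP: ik; apply/val_inj.
rewrite LfunE mom_default // big1 // => i _; rewrite coefXn.
by rewrite ltn_eqF ?mul0r // (leq_trans (ltn_ord i)).
Qed.

(** This bilinear form need not be symmetric; on polynomials of degree at most [j./2], [Dmx m j] is
    the matrix of its symmetric part. *)
Definition shift_form (j : nat) (p q : {poly R}) : R :=
  L ('X^(odd j) * p * (q \Po ('X - 1))).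

Lemma shift_formZDl j a p1 p2 q :
  shift_form j (a *: p1 + p2) q = a * shift_form j p1 q + shift_form j p2 q.
Proof.
by rewrite /shift_form mulrDr mulrDl -scalerAr -scalerAl linearP.
Qed.

Lemma shift_formZDr j a p q1 q2 :
  shift_form j p (a *: q1 + q2) = a * shift_form j p q1 + shift_form j p q2.
Proof.
by rewrite /shift_form comp_polyD comp_polyZ mulrDr -scalerAr linearP.
Qed.

(** Thus [Hmx] is the matrix of the shift p(x) -> p(x - 1) in the monomial basis. *)
Lemma Hmx_col k (l : 'I_k.+1) :
  ('X - 1) ^+ l = \sum_(i < k.+1) Hmx R k i l *: 'X^i :> {poly R}.
Proof.
rewrite addrC exprDn.
rewrite (big_ord_widen k.+1 (fun i => (-1) ^+ (l - i) * 'X^i *+ 'C(l, i))) //.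
rewrite big_mkcond; apply: eq_bigr => i _; rewrite mxE ltnS.
case: leqP => _; last by rewrite scale0r.
by rewrite -mul_polyC rmorphM /= rmorphXn /= rmorphN1 /= rmorph_nat mulrAC mulr_natr.
Qed.

Lemma shift_form_Xn j (i l : 'I_(j./2).+1) :
  shift_form j 'X^i 'X^l =
  ((if odd j then Bmx m j./2 else Amx m j./2) *m Hmx R j./2) i l.
Proof.
rewrite /shift_form comp_Xn_poly Hmx_col mulr_sumr linear_sum mxE.
apply: eq_bigr => k _ /=.
rewrite -scalerAr linearZ /= mulrC -!exprD LfunXn; congr (_ * _).
by case: (odd j); rewrite mxE.
Qed.

Lemma shift_formE j (u v : 'cV[R]_(j./2).+1) :
  shift_form j (rVpoly u^T) (rVpoly v^T) =
  (u^T *m ((if odd j then Bmx m j./2 else Amx m j./2) *m Hmx R j./2) *m v) 0 0.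
Proof.
have rVE (w : 'cV[R]_(j./2).+1) : rVpoly w^T = \sum_i w i 0 *: 'X^i.
  rewrite /rVpoly poly_def; apply: eq_bigr => i _.
  by rewrite insubT // => h; rewrite mxE; congr (w _ _ *: _); apply: val_inj.
rewrite !rVE /shift_form mulr_sumr mulr_suml linear_sum mxE.
rewrite [RHS](eq_bigr (fun l : 'I__ => \sum_i u i 0 * shift_form j 'X^i 'X^l * v l 0)); last first.
  move=> l _; rewrite mxE mulr_suml; apply: eq_bigr => i _.
  by rewrite mxE shift_form_Xn.
rewrite exchange_big; apply: eq_bigr => i _ /=.
rewrite [X in _ * X]raddf_sum mulr_sumr linear_sum; apply: eq_bigr => l _ /=.
rewrite comp_polyZ -!(scalerAl, scalerAr) !linearZ /= /shift_form; ring.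
Qed.

(** The two halves of [Dmx] are transposes of each other, hence give the same value on the
    diagonal. *)
Lemma Dmx_form j (v : 'cV[R]_(j./2).+1) :
  (v^T *m Dmx m j *m v) 0 0 = shift_form j (rVpoly v^T) (rVpoly v^T).
Proof.
rewrite shift_formE /Dmx /=; set M := if odd j then _ else _.
have MT : M^T = M.
  by rewrite /M; case: ifP => _; apply/matrixP => i k; rewrite !mxE [(k + i)%N]addnC.
have tr : v^T *m ((Hmx R j./2)^T *m M) *m v = (v^T *m (M *m Hmx R j./2) *m v)^T.
  by rewrite !trmx_mul trmxK MT !mulmxA.
rewrite -scalemxAr -scalemxAl mulmxDr mulmxDl tr.
by move: (v^T *m (M *m Hmx R j./2) *m v) => X; rewrite !mxE; lra.
Qed.

Section Form.
Variable j : nat.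
Hypothesis posD : posdefmx (Dmx m j).

Lemma shift_form_gt0 (p : {poly R}) : (size p <= (j./2).+1)%N -> p != 0 ->
  0 < shift_form j p p.
Proof.
move=> sp p0; rewrite -(poly_rV_K sp) -[poly_rV p]trmxK -Dmx_form.
apply: posD.2; apply: contraNneq p0 => /(congr1 trmx).
by rewrite trmxK trmx0 => e; rewrite -(poly_rV_K sp) e linear0.
Qed.

Lemma shift_form_bound (g : {poly R} -> R) : linear_for *%R g ->
  exists2 C : R, 0 <= C & forall p : {poly R}, (size p <= (j./2).+1)%N ->
    g p ^+ 2 <= C * shift_form j p p.
Proof.
move=> lin_g.
pose G : {linear {poly R} -> R | *%R} :=
  HB.pack g (GRing.isLinear.Build R {poly R} R *%R g lin_g).
have [C C0 bnd] := posdefmx_functional_bound posD (\row_i G 'X^i).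
exists C => // p sp; have := bnd (poly_rV p)^T.
rewrite Dmx_form trmxK poly_rV_K // => /(le_trans _); apply.
rewrite -[g]/(G : _ -> _) -{1}(poly_rV_K sp) /rVpoly poly_def linear_sum mxE.
rewrite [X in X ^+ 2](eq_bigr (fun i => (\row_i G 'X^i) 0 i * (poly_rV p)^T i 0)) //.
move=> i _; rewrite insubT // => h; rewrite linearZ /= mulrC.
have -> : Sub (val i) h = i by apply: val_inj.
by rewrite !mxE.
Qed.

End Form.
End MomentFunctional.

(** * Node polynomials: signs, growth of the roots and Lagrange interpolation *)

Section NodalPolynomial.
Variable R : realType.

Definition nodal (s : seq nat) : {poly R} := \prod_(a <- s) ('X - a%:R%:P).

Lemma nodal_monic s : nodal s \is monic.
Proof. exact: monic_prod_XsubC. Qed.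

Lemma size_nodal s : size (nodal s) = (size s).+1.
Proof. exact: size_prod_XsubC. Qed.

Lemma nodal_cons a s : nodal (a :: s) = ('X - a%:R%:P) * nodal s.
Proof. exact: big_cons. Qed.

Lemma nodal_perm s s' : perm_eq s s' -> nodal s = nodal s'.
Proof. exact: perm_big. Qed.

Lemma nodal_pairs k t : nodal (nseq (odd k) 0 ++ t ++ map S t) =
  'X^(odd k) * nodal t * (nodal t \Po ('X - 1)).
Proof.
rewrite /nodal !big_cat /= -mulrA; congr (_ * (_ * _)).
  by case: (odd k); rewrite ?big_nil // big_seq1 subr0.
rewrite big_map rmorph_prod; apply: eq_bigr => a _.
by rewrite rmorphB /= comp_polyX comp_polyC -natr1 rmorphD /= rmorph1 opprD addrAC addrA.
Qed.

Lemma nodal_root s (b : nat) : b \in s -> (nodal s).[b%:R] = 0.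
Proof.
by move=> /perm_to_rem/nodal_perm ->; rewrite nodal_cons !hornerE subrr mul0r.
Qed.

Lemma nodal_sign s (x : nat) : x \notin s ->
  0 < (-1) ^+ count (ltn x) s * (nodal s).[x%:R].
Proof.
elim: s => [|a s IHs]; first by rewrite /nodal big_nil hornerC mul1r ltr01.
rewrite inE negb_or nodal_cons hornerM hornerXsubC /= => /andP[xa /IHs].
rewrite exprD mulrACA => h; rewrite mulr_gt0 //.
case: ltngtP xa => // ax _; rewrite ?expr1 ?expr0 ?mul1r ?mulN1r ?oppr_gt0 ?subr_gt0 ?subr_lt0.
  by rewrite ltr_nat.
by rewrite ltr_nat.
Qed.

(** At -1 each factor has absolute value 1 + b, at least 1, so the product dominates every factor. A
    bound on this single value therefore bounds all the nodes. *)
Lemma nodal_norm_ge s : 1 <= `|(nodal s).[-1]| /\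
  forall a : nat, a \in s -> a%:R <= `|(nodal s).[-1]|.
Proof.
elim: s => [|b s [IH1 IHs]]; first by rewrite /nodal big_nil hornerC normr1.
rewrite nodal_cons hornerM hornerXsubC normrM.
have -> : `|-1 - b%:R : R| = 1 + b%:R.
  by rewrite -opprD normrN ger0_norm // addr_ge0.
have b0 : 0 <= b%:R :> R by [].
split; first by nra.
move=> a; rewrite inE => /predU1P[->|/IHs]; nra.
Qed.

Lemma even_above_nodal s : uniq s ->
  (forall x : nat, 0 <= (nodal s).[x%:R]) -> even_above s.
Proof.
move=> us ge0; split=> // x /nodal_sign; rewrite -signr_odd.
by case: (odd _) => //; rewrite mulN1r oppr_gt0 ltNge ge0.
Qed.

(** The polynomials [nodal (rem b s)] are the unnormalized Lagrange basis; the difference of the two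
    sides has more roots than its degree allows. *)
Lemma lagrange_nodal s (P : {poly R}) : uniq s -> (size P <= size s)%N ->
  P = \sum_(b <- s) (P.[b%:R] / (nodal (rem b s)).[b%:R]) *: nodal (rem b s).
Proof.
move=> us sP; apply/eqP; rewrite -subr_eq0; apply/eqP.
apply: (@roots_geq_poly_eq0 _ _ (map (fun a : nat => a%:R) s)).
- apply/allP => _ /mapP[a sa ->]; rewrite rootE !hornerE horner_sum.
  rewrite (bigD1_seq a) //= big1_seq ?addr0 => [|b /andP[ba sb]].
    rewrite hornerZ divfK ?subrr //; apply/eqP => z.
    have := @nodal_sign (rem a s) a; rewrite mem_rem_uniq // inE eqxx z mulr0 ltxx.
    by move/(_ isT).
  by rewrite hornerZ (@nodal_root _ a) ?mulr0 // mem_rem_uniq // inE eq_sym ba.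
- by rewrite map_inj_uniq // => x y /eqP; rewrite eqr_nat => /eqP.
rewrite size_map (leq_trans (size_polyD _ _)) // geq_max sP size_polyN.
rewrite big_seq; apply: (big_ind (fun Q : {poly R} => (size Q <= size s)%N)).
- by rewrite size_poly0.
- by move=> p q sp sq; rewrite (leq_trans (size_polyD _ _)) // geq_max sp.
move=> b sb; rewrite (leq_trans (size_scale_leq _ _)) // size_nodal size_rem //.
by rewrite prednK //; case: (s) sb.
Qed.

End NodalPolynomial.

(** * Minimizing node sets and nonnegative quadrature weights *)

Section Quadrature.
Variables (R : realType) (n : nat) (m : n.-tuple R).
Local Notation L := (Defs.Lfun m).
Local Notation nodal := (nodal R).

Lemma Lfun_nodal s : even_above s -> exists t : seq nat,
  [/\ size t = (size s)./2, perm_eq s (nseq (odd (size s)) 0 ++ t ++ map S t) &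
      L (nodal s) = shift_form m (size s) (nodal t) (nodal t)].
Proof.
move=> /even_above_pairs[t [st pt]]; exists t; split=> //.
by rewrite (nodal_perm R pt) nodal_pairs.
Qed.

Lemma Lfun_nodal_gt0 s : even_above s -> posdefmx (Dmx m (size s)) ->
  0 < L (nodal s).
Proof.
move=> /Lfun_nodal[t [st _ ->]] posD; apply: shift_form_gt0 => //.
  by rewrite size_nodal st.
by rewrite monic_neq0 // nodal_monic.
Qed.

(* Here [j.+2] may exceed [n] by one, and [L] then reads the junk moment 0 of
   order [n.+1]; its value is irrelevant because it only enters the constant
   [B 'X^k 'X^k], the leading coefficient of [nodal t] being fixed. *)
Lemma Lfun_nodal_coercive (j : nat) (c : R) : posdefmx (Dmx m j) ->
  exists N : nat, forall s, even_above s -> size s = j.+2 ->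
    L (nodal s) <= c -> forall a, a \in s -> (a < N)%N.
Proof.
move=> posD; set k := (j./2).+1.
pose B := shift_form m j; pose g p := B p 'X^k + B 'X^k p.
have [C C0 gC] : exists2 C : R, 0 <= C & forall p : {poly R}, (size p <= k)%N ->
    g p ^+ 2 <= C * B p p.
  apply: shift_form_bound => // a p q.
  by rewrite /g /B shift_formZDl shift_formZDr mulrDr addrACA.
have [C' C'0 eC] : exists2 C : R, 0 <= C & forall p : {poly R}, (size p <= k)%N ->
    p.[-1] ^+ 2 <= C * B p p.
  by apply: shift_form_bound => // a p q; rewrite !hornerE.
(* With [nodal t] written as [q + 'X^k], the bound on [g] gives 2|g(q)| <= B(q, q) + C by the
   arithmetic-geometric mean inequality, so a value at most [c] forces B(q, q) <= [K]. *)
pose K := 2 * (c - B 'X^k 'X^k) + C.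
(* One unit comes from |y| <= y^2 + 1 at y = q(-1), the other from |(-1)^k| = 1. *)
pose b := C' * `|K| + 2.
have [N bN] : exists N : nat, b <= N%:R.
  by exists (Num.truncn b).+1; apply: ltW; apply: truncnS_gt.
(* Elements of [t] are at most [N], and their partners in [map S t] at most [N.+1]. *)
exists N.+2 => s es ss Ls a sa.
have [t [st pt Lt]] := Lfun_nodal es.
have {}st : size t = k by rewrite st ss.
have {}Lt : B (nodal t) (nodal t) <= c.
  by rewrite -[B _ _](_ : L (nodal s) = _) // Lt ss /B /shift_form /= negbK.
pose q := nodal t - 'X^k.
have sq : (size q <= k)%N.
  apply/leq_sizeP => i ki; rewrite coefB coefXn.
  move: ki; rewrite leq_eqVlt => /predU1P[<-|ki]; last first.
    by rewrite gtn_eqF // subr0 nth_default // size_nodal st.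
  have /monicP := nodal_monic R t; rewrite lead_coefE size_nodal st => ->.
  by rewrite eqxx subrr.
have tE : nodal t = 1 *: q + 'X^k by rewrite scale1r subrK.
have BE : B (nodal t) (nodal t) = B q q + g q + B 'X^k 'X^k.
  by rewrite /B tE shift_formZDl !shift_formZDr /g /B; ring.
have qK : B q q <= K.
  have Bq0 : 0 <= B q q.
    have [->|q0] := eqVneq q 0; first by rewrite /B /shift_form mulr0 mul0r linear0.
    exact: ltW (shift_form_gt0 posD sq q0).
  rewrite leNgt; apply/negP => Kq.
  have gn : B q q + C < - (2 * g q) by move: Lt Kq; rewrite BE /K; lra.
  have : (B q q + C) ^+ 2 < (- (2 * g q)) ^+ 2.
    by rewrite ltr_pXn2r // nnegrE; lra.
  have := gC q sq; have := sqr_ge0 (B q q - C); nra.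
have q1 : q.[-1] ^+ 2 <= C' * `|K|.
  by apply: le_trans (eC q sq) _; rewrite ler_wpM2l // (le_trans qK) // ler_norm.
have t1 : `|(nodal t).[-1]| <= b.
  rewrite tE scale1r hornerD hornerXn (le_trans (ler_normD _ _)) // normrX normrN1 expr1n.
  have := real_normK (num_real q.[-1]); rewrite /b.
  have := normr_ge0 q.[-1]; move: q1; nra.
have ltt x : x \in t -> (x < N.+1)%N.
  move=> /((nodal_norm_ge R t).2) xt; rewrite ltnS -(ler_nat R).
  exact: le_trans xt (le_trans t1 bN).
move: sa; rewrite (perm_mem pt) !mem_cat => /or3P[||/mapP[x xt ->]].
- by rewrite mem_nseq => /andP[_ /eqP->].
- by move=> /ltt/leqW.
- exact: ltt.
Qed.

(** By coercivity, the sets doing no worse than the initial segment [s0] have all nodes below some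
    [N]; encoded as tuples over ['I_N] they lie in a finite type, where a minimum exists. *)
Lemma Lfun_nodal_minimizer (j : nat) : posdefmx (Dmx m j) ->
  exists s, [/\ even_above s, size s = j.+2 & forall s', even_above s' ->
    size s' = j.+2 -> L (nodal s) <= L (nodal s')].
Proof.
move=> posD; pose s0 := iota 0 j.+2.
have es0 : even_above s0.
  split=> [|x]; first exact: iota_uniq.
  rewrite mem_iota add0n leq0n andTb -leqNgt => jx.
  rewrite (@eq_in_count _ _ pred0) ?count_pred0 // => y.
  by rewrite mem_iota add0n => /andP[_ yj] /=; apply/negbTE; rewrite -leqNgt; lia.
have ss0 : size s0 = j.+2 by rewrite size_iota.
have [N bN] := Lfun_nodal_coercive (L (nodal s0)) posD.
pose F (u : (j.+2).-tuple 'I_N) := L (nodal (map val u)).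
have toT s : even_above s -> size s = j.+2 -> L (nodal s) <= L (nodal s0) ->
    exists u : (j.+2).-tuple 'I_N, map val u = s.
  move=> es ss Ls; have /all_sigP[r rs] : all (fun i => i < N)%N s.
    by apply/allP; apply: bN.
  have sr : size (map (fun i : {i | i < N}%N => Ordinal (valP i)) r) == j.+2.
    by rewrite size_map -ss rs size_map.
  by exists (Tuple sr); rewrite /= -map_comp rs.
have [u0 u0E] := toT s0 es0 ss0 (lexx _).
pose P (u : (j.+2).-tuple 'I_N) := `[< even_above (map val u) >].
have Pu0 : P u0 by apply/asboolP; rewrite u0E.
case: (arg_minP F Pu0) => u /asboolP eu minu.
exists (map val u); split=> //; first by rewrite size_map size_tuple.
move=> s es ss; have [Ls|/ltW] := leP (L (nodal s)) (L (nodal s0)).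
  have [v vE] := toT s es ss Ls.
  by have := minu v; rewrite /F /P vE; apply; apply/asboolP.
by apply: le_trans; have := minu u0 Pu0; rewrite /F u0E.
Qed.

(* Exchanging [b] for [c] replaces the node polynomial [(X - b) Q] by
   [(X - c) Q], so minimality fixes the sign of [(b - c) L(Q)]. *)
Lemma quadrature_weight_ge0 s b : even_above s ->
  posdefmx (Dmx m (size s).-1) ->
  (forall s', even_above s' -> size s' = size s -> L (nodal s) <= L (nodal s')) ->
  b \in s -> 0 <= L (nodal (rem b s)) / (nodal (rem b s)).[b%:R].
Proof.
move=> es posD min_s sb; set Q := nodal (rem b s).
have sgnQ : 0 < (-1) ^+ count (ltn b) s * Q.[b%:R].
  have -> : count (ltn b) s = count (ltn b) (rem b s).
    by rewrite (permP (perm_to_rem sb)) /= ltnn.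
  by apply: nodal_sign; rewrite (mem_rem_uniq _ es.1) inE eqxx.
have exch c : even_above (c :: rem b s) -> 0 <= (b%:R - c%:R) * L Q.
  move=> /min_s; rewrite /= size_rem // prednK; last by case: (s) sb.
  move=> /(_ erefl); rewrite (nodal_perm R (perm_to_rem sb)) !nodal_cons -/Q.
  rewrite -subr_ge0 -linearB /= -mulrBl opprB addrC addrA subrK -polyCB mul_polyC.
  by rewrite linearZ.
move: sgnQ; rewrite -signr_odd.
(* The parity above [b] is the sign of Q(b), and it also decides on which side of [b] the exchange
   partner lies, so L(Q) and Q(b) have compatible signs. *)
case: (even_above_exchange es sb) => [[/negbTE-> er]|[-> [c bc ec]]|[/negbTE-> [c cb ec]]].
- rewrite mul1r => Qb; apply: divr_ge0; apply/ltW => //.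
  by apply: Lfun_nodal_gt0; rewrite ?size_rem.
- rewrite mulN1r oppr_gt0 => Qb; have := exch c ec.
  rewrite nmulr_rge0; last by rewrite subr_lt0 ltr_nat.
  by move=> LQ; rewrite -mulrNN -invrN divr_ge0 // oppr_ge0 // ltW.
- rewrite mul1r => Qb; have := exch c ec.
  rewrite pmulr_rge0; last by rewrite subr_gt0 ltr_nat.
  by move=> LQ; rewrite divr_ge0 // ltW.
Qed.

Lemma realizable_of_quadrature (s : seq nat) (w : nat -> R) :
  (forall b, b \in s -> 0 <= w b) ->
  (forall k, (k <= n)%N -> \sum_(b <- s) w b * b%:R ^+ k = mom m k) ->
  realizable m.
Proof.
move=> w0 ws.
(* The absolute value makes the scaling factor nonnegative for every [i]; on the nodes it equals the
   weight. *)
pose mu_ (i : nat) : {measure set nat -> \bar R} :=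
  mscale (NngNum (normr_ge0 (w (nth 0%N s i)))) \d_(nth 0%N s i).
pose mu := msum mu_ (size s).
have int_mu (k : nat) : (k <= n)%N ->
    (\int[mu]_x (((x%:R : R) ^+ k)%:E) = (mom m k)%:E)%E.
  move=> kn; rewrite ge0_integral_measure_sum //=.
  rewrite -ws // (big_nth 0%N) big_mkord -sumEFin; apply: eq_bigr => i _.
  rewrite ge0_integral_mscale // integral_dirac // diracT mul1e -EFinM /=.
  by rewrite ger0_norm // w0 // mem_nth.
(* Total mass one is the moment identity of order 0. *)
have mu1 : mu setT = 1%E.
  have := int_mu 0%N isT.
  under eq_integral do rewrite expr0.
  by rewrite integral_cst // mul1e.
pose P : probability nat R := HB.pack mu (Measure_isProbability.Build _ _ _ mu mu1).
by exists P => k /andP[_ kn]; rewrite -int_mu.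
Qed.

End Quadrature.

(** * Realizability and I-realizability *)

Theorem theorem7p1 (R : realType) (n : nat) (hn : (1 <= n)%N)
    (m : n.-tuple R)
    (hD : forall j : nat, (1 <= j <= n)%N -> posdefmx (Dmx m j)) :
  realizable m /\ I_realizable m.
Proof.
have posD j : (j <= n)%N -> posdefmx (Dmx m j).
  case: j => [_|j jn]; last exact: hD.
  (* The hypothesis starts at j = 1; order 0, needed when n = 1, follows from m_0 = 1. *)
  have D0 : Dmx m 0 = 1%:M.
    apply/matrixP => i k; rewrite (ord1 i) (ord1 k) /Dmx /=.
    by rewrite !mxE !big_ord1 !mxE /= /mom /= bin0; field.
  rewrite D0; split; first by rewrite is_hermitianmxE expr0 scale1r map_mx_id // trmx1.
  move=> v /eqP v0; rewrite mulmx1 mxE big_ord1 mxE -expr2 lt_neqAle sqr_ge0 andbT.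
  rewrite eq_sym sqrf_eq0; apply/eqP => v00; apply: v0; apply/colP => i.
  by rewrite (ord1 i) v00 mxE.
have realm : realizable m.
  have [//|s [es ss min_s]] := @Lfun_nodal_minimizer R n m n.-1 _.
    by apply: posD; rewrite leq_pred.
  rewrite prednK // in ss min_s.
  pose Q b := nodal R (rem b s).
  apply: (@realizable_of_quadrature R n m s (fun b => Defs.Lfun m (Q b) / (Q b).[b%:R])).
    move=> b; apply: quadrature_weight_ge0 => //; first by apply: posD; rewrite ss.
    by rewrite ss.
  (* There are [n.+1] nodes, so interpolation is exact for all degrees up to [n]. *)
  move=> k kn; rewrite -LfunXn (lagrange_nodal es.1 (P := 'X^k)) ?size_polyXn ?ss //.
  rewrite linear_sum; apply: eq_bigr => b _ /=.
  by rewrite linearZ /= hornerXn mulrC mulrA mulrAC.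
split=> //; split=> // P PP.
have [k kn [mP sP [s [us ss rs]] ge0]] : exists2 k, (k <= n)%N & Pset k P.
  by case: PP => PP; [exists n | exists n.-1; rewrite ?leq_pred].
have PE : P = nodal R s.
  rewrite [LHS](@all_roots_prod_XsubC _ _ (map (fun a : nat => a%:R) s)).
  - by rewrite (monicP mP) scale1r big_map.
  - by rewrite size_map ss.
  - by rewrite all_map.
  by rewrite uniq_rootsE map_inj_uniq // => x y /eqP; rewrite eqr_nat => /eqP.
rewrite PE; apply: Lfun_nodal_gt0; last by apply: posD; rewrite ss.
by apply: (@even_above_nodal R) => // x; rewrite -PE.
Qed.
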